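(* Let $\mathcal{A},\mathcal{C},r$ be the data of the constrained least-squares problem described in the context, with perturbations $\Delta\mathcal{A},\Delta\mathcal{C},\Delta r$; let $c$ be the solution of the unperturbed problem, $\tilde c$ the solution of the perturbed problem, and $\Delta c=c-\tilde c$. Let $\|\Delta\mathcal{A}\|$ and $\|\Delta\mathcal{C}\|$ be sufficiently small such that $\varkappa=\|\mathcal{C}^+\|\,\|\Delta\mathcal{C}\|<1/2$ and \[ \|(\mathcal{A}P)^+\|\left\{\|\Delta\mathcal{A}P\|+\|\mathcal{A}+\Delta\mathcal{A}\|\frac{\|\mathcal{C}^+\|}{1-\varkappa}\left[\sqrt2\,\kappa(\mathcal{C})+1\right]\|\Delta\mathcal{C}\|\right\}<1 . \] Then \[ |\Delta c|\le\frac{\|(\mathcal{A}P)^+\|}{1-\omega_\Delta}\left\{\|\mathfrak{R}\|\left[|c|+\|(\mathcal{A}P)^+\|\,|\mathfrak{r}|\right]+|\Delta r|\right\}+\frac{\|\mathcal{C}^+\|}{1-\varkappa}\left[\sqrt2\,\kappa(\mathcal{C})+1\right]\|\Delta\mathcal{C}\|\,|c| \] and, if $c\neq0$, \[ \frac{|\Delta c|}{|c|}\le\frac{1}{1-\omega_\Delta}\left\{\left[\kappa_{\mathcal{C}}(\mathcal{A})+\frac{|\mathfrak{r}|}{\|\mathcal{A}P\|\,|c|}\kappa_{\mathcal{C}}(\mathcal{A})^2\right]\frac{\|\mathfrak{R}\|}{\|\mathcal{A}P\|}+\frac{\|(\mathcal{A}P)^+\|\,|r|}{|c|}\cdot\frac{|\Delta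 r|}{|r|}\right\}+\frac{\|\mathcal{C}^+\|}{1-\varkappa}\left[\sqrt2\,\kappa(\mathcal{C})+1\right]\|\Delta\mathcal{C}\| . \]
   Context: Discrete problem. Let $[a,b]$ be a compact interval, $k<m$ positive integers, $N\ge1$, $n\ge2$, $M\ge N+1$ integers, $a=t_0<\dots<t_n=b$ a partition, $h_j=t_j-t_{j-1}$. Given are the linear boundary value problem $A(t)(Dx)'(t)+B(t)x(t)=q(t)$, $G_ax(a)+G_bx(b)=d$, with $D=[I_k\ 0]\in\mathbb{R}^{k\times m}$, sufficiently smooth $A(t)\in\mathbb{R}^{m\times k}$, $B(t)\in\mathbb{R}^{m\times m}$, $q(t)\in\mathbb{R}^m$, and $G_a,G_b\in\mathbb{R}^{l\times m}$ ($l$ the dynamical degree of freedom of the equation), $\ker D\subseteq\ker G_a\cap\ker G_b$. Basis: $\{p_0,\dots,p_{N-1}\}$ is a basis of the polynomials of degree $\le N-1$ on $[0,1]$; $\bar p_0=1$, $\bar p_i(\tau)=\int_0^\tau p_{i-1}(\sigma)d\sigma$ ($i=1,\dots,N$); $p_{ji}(t)=p_i((t-t_{j-1})/h_j)$, $\bar p_{ji}(t)=h_j\bar p_i((t-t_{j-1})/h_j)$. A vector $c\in\mathbb{R}^{n(mN+k)}$ with entries $c_{j\kappa l}$ ($j=1,\dots,n$; $\kappa=1,\dots,m$; $l=0,\dots,N$ if $\kappa\le k$, $l=0,\dots,N-1$ if $\kappa>k$) represents the piecewise polynomial function with pieces $x_j=(x_{j1},\dots,x_{jm})^T$ on the $j$-th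 subinterval, $x_{j\kappa}=\sum_{l=0}^Nc_{j\kappa l}\bar p_{jl}$ ($\kappa\le k$), $x_{j\kappa}=\sum_{l=0}^{N-1}c_{j\kappa l}p_{jl}$ ($\kappa>k$). Constraint matrix: $\mathcal{C}\in\mathbb{R}^{k(n-1)\times n(mN+k)}$ is the matrix such that the entries of $\mathcal{C}c$ are the jumps $x_{j\kappa}(t_j)-x_{j+1,\kappa}(t_j)$, $j=1,\dots,n-1$ (outer index), $\kappa=1,\dots,k$ (inner index). It has full row rank. Least-squares matrix: given collocation points $0\le\rho_1<\dots<\rho_M\le1$, $t_{ji}=t_{j-1}+\rho_ih_j$, and a symmetric positive definite $L\in\mathbb{R}^{M\times M}$, let $w_j=A(Dx_j)'+Bx_j-q$ and let $W\in\mathbb{R}^{mMn}$ be the stacked vector of $W_j=h_j^{1/2}(w_j(t_{j1}),\dots,w_j(t_{jM}))$, $j=1,\dots,n$, and $\mathcal{L}=\mathrm{diag}(L\otimes I_m,\dots,L\otimes I_m)$. The matrix $\mathcal{A}\in\mathbb{R}^{(nmM+l)\times n(mN+k)}$ and $r\in\mathbb{R}^{nmM+l}$ are defined by the affine identity $\mathcal{A}c-r=\begin{bmatrix}\mathcal{L}^{1/2}W\\ G_ax_1(a)+G_bx_n(b)-d\end{bmatrix}$ for all $c$. Unperturbed problem: minimize $|\mathcal{A}c-r|^2$ subject to $\mathcal{C}c=0$. Perturbed problem: minimize $|(\mathcal{A}+\Delta\mathcal{A})z-(r+\Delta r)|$ subject to $(\mathcal{C}+\Delta\mathcal{C})z=0$,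 where $\Delta\mathcal{A},\Delta\mathcal{C},\Delta r$ have the same sizes as $\mathcal{A},\mathcal{C},r$. Notation: $|\cdot|$ is the Euclidean norm, $\|\cdot\|$ the spectral norm, $\mathcal{M}^+$ the Moore–Penrose inverse. $P=I-\mathcal{C}^+\mathcal{C}$ is the orthogonal projector onto $\ker\mathcal{C}$; $\mathcal{D}$ is a matrix whose columns form an orthonormal basis of $\ker\mathcal{C}$. Standing assumption: $\mathcal{A}\mathcal{D}$ has full column rank. $P_\Delta=I-(\mathcal{C}+\Delta\mathcal{C})^+(\mathcal{C}+\Delta\mathcal{C})$, $\mathcal{D}_\Delta=P_\Delta\mathcal{D}$, $\mathfrak{R}=\Delta\mathcal{A}\,\mathcal{D}+(\mathcal{A}+\Delta\mathcal{A})(\mathcal{D}_\Delta-\mathcal{D})$, $\omega_\Delta=\|(\mathcal{A}P)^+\|\,\|\mathfrak{R}\|$, $\mathfrak{r}=r-\mathcal{A}c$, $\kappa(\mathcal{C})=\|\mathcal{C}\|\,\|\mathcal{C}^+\|$, $\kappa_{\mathcal{C}}(\mathcal{A})=\|\mathcal{A}P\|\,\|(\mathcal{A}P)^+\|$. *)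

(* Defs.v *)
(* The partition points are t 0 < ... < t n.  Every other index that starts at 1
   in the usual notation is shifted to start at 0: the subinterval with index
   j : 'I_n is [t j, t j.+1], the components of x have indices 0, ..., m - 1. *)
From mathcomp Require Import all_boot all_order all_algebra.
From mathcomp Require Import all_classical all_reals all_analysis.
Import Order.TTheory GRing.Theory Num.Theory numFieldNormedType.Exports.

Set Implicit Arguments.
Unset Strict Implicit.
Unset Printing Implicit Defensive.

Local Open Scope classical_set_scope.
Local Open Scope ring_scope.

(* The norm that MathComp-Analysis puts on matrices is the maximum norm. *)
Definition enorm (R : realType) (p : nat) (v : 'cV[R]_p) : R :=
  Num.sqrt (\sum_(i < p) v i 0 ^+ 2).

Definition spectral_norm (R : realType) (p q : nat) (X : 'M[R]_(p, q)) : R :=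
  sup [set enorm (X *m v) | v in [set v : 'cV[R]_q | enorm v <= 1]].

Definition penrose (R : realType) (p q : nat) (X : 'M[R]_(p, q))
    (Y : 'M[R]_(q, p)) : Prop :=
  [/\ X *m Y *m X = X, Y *m X *m Y = Y,
      (X *m Y)^T = X *m Y & (Y *m X)^T = Y *m X].

(* The Moore-Penrose inverse; see mp_invP below for its existence. *)
Definition mp_inv (R : realType) (p q : nat) (X : 'M[R]_(p, q)) : 'M[R]_(q, p) :=
  xget 0 [set Y | penrose X Y].

Definition sympd (R : realType) (p : nat) (X : 'M[R]_p) : Prop :=
  X^T = X /\ forall v : 'cV[R]_p, v != 0 -> 0 < (v^T *m X *m v) 0 0.

(* Only meant for symmetric positive definite X, whose symmetric positive
   definite square root exists and is unique. *)
Definition sqrt_mx (R : realType) (p : nat) (X : 'M[R]_p) : 'M[R]_p :=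
  xget 0 [set Y | sympd Y /\ Y *m Y = X].

Definition minimizer (T : Type) (F : set T) (R : realType) (f : T -> R)
    (x : T) : Prop :=
  F x /\ forall y, F y -> f x <= f y.

Definition orthonormal_basis_ker (R : realType) (p q s : nat)
    (X : 'M[R]_(p, q)) (E : 'M[R]_(q, s)) : Prop :=
  E^T *m E = 1%:M /\
  forall v : 'cV[R]_q, X *m v = 0 <-> exists y : 'cV[R]_s, v = E *m y.

(* The integral from 0 to tau, oriented, so that it is the polynomial primitive
   on all of R; at most one of the two terms is nonzero. *)
Definition int0 (R : realType) (f : R -> R) (tau : R) : R :=
  Rintegral (@lebesgue_measure R) `[0, tau] f
  - Rintegral (@lebesgue_measure R) `[tau, 0] f.

Definition pbar (R : realType) (N : nat) (p : N.-tuple {poly_N R}) (i : nat)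
    (tau : R) : R :=
  if i is i'.+1 then int0 (fun sigma => (p`_i' : {poly R}).[sigma]) tau else 1.

Definition step (R : realType) (t : nat -> R) (j : nat) : R := t j.+1 - t j.

Definition pj (R : realType) (N : nat) (p : N.-tuple {poly_N R})
    (t : nat -> R) (j i : nat) (s : R) : R :=
  (p`_i : {poly R}).[(s - t j) / step t j].

Definition pbarj (R : realType) (N : nat) (p : N.-tuple {poly_N R})
    (t : nat -> R) (j i : nat) (s : R) : R :=
  step t j * pbar p i ((s - t j) / step t j).

Definition ncoef (k N kappa : nat) : nat := if (kappa < k)%N then N.+1 else N.

(* A coefficient vector (c_(j kappa l)), in lexicographic order, has type
   'cV[R]_(coef_dim n m k N); the nested sum, equal to n * (m * N + k), gives
   access to its blocks by submxcol. *)
Notation coef_dim n m k N :=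
  (\sum_(j < n) \sum_(kappa < m) ncoef k N kappa)%N.

Notation colloc_dim n m M := (\sum_(j < n) \sum_(i < M) m)%N.

Notation jump_dim n k := (\sum_(j < n.-1) k)%N.

Lemma dim_coef (n m k N : nat) : (k <= m)%N ->
  (coef_dim n m k N = n * (m * N + k))%N.
Proof.
move=> km; rewrite sum_nat_const card_ord; congr (_ * _)%N.
transitivity (\sum_(i < m) (N + (i < k)))%N.
  by apply: eq_bigr => i _; rewrite /ncoef; case: ifP; rewrite ?addn1 ?addn0.
rewrite big_split /= sum_nat_const card_ord; congr (_ + _)%N.
rewrite -(big_mkord xpredT (fun i => (i < k)%N : nat)).
rewrite (big_cat_nat (n := k)) //=.
rewrite [X in (_ + X)%N]big1_seq ?addn0; last first.
  by move=> i; rewrite mem_index_iota => /andP[_ /andP[ki _]]; rewrite ltnNge ki.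
rewrite (eq_big_nat _ _ (F2 := fun=> 1%N)); last by move=> i /andP[_ ->].
by rewrite sum_nat_const_nat subn0 muln1.
Qed.

Definition coef_at (R : realType) (n m k N : nat) (c : 'cV[R]_(coef_dim n m k N))
    (j : 'I_n) (kappa : 'I_m) (l : 'I_(ncoef k N kappa)) : R :=
  submxcol (submxcol c j) kappa l 0.

(* The polynomial x_j representing the function on [t j, t j.+1], extended to
   all of R. *)
Definition piece (R : realType) (n m k N : nat) (p : N.-tuple {poly_N R})
    (t : nat -> R) (c : 'cV[R]_(coef_dim n m k N)) (j : 'I_n) (s : R) : 'cV[R]_m :=
  \col_(kappa < m) \sum_(l < ncoef k N kappa)
    coef_at c j l * (if (kappa < k)%N then pbarj p t j l s else pj p t j l s).

Definition Dmx (R : realType) (k m : nat) : 'M[R]_(k, m) := pid_mx k.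

Definition first_ord (n : nat) (n0 : (0 < n)%N) : 'I_n := Ordinal n0.
Definition last_ord (n : nat) (n0 : (0 < n)%N) : 'I_n := rev_ord (Ordinal n0).

Definition left_ord (n : nat) (j : 'I_n.-1) : 'I_n := widen_ord (leq_pred n) j.
Definition right_ord (n : nat) (j : 'I_n.-1) : 'I_n :=
  Ordinal (etrans (esym (ltn_predRL j n)) (ltn_ord j)).

Definition jump (R : realType) (n m k N : nat) (p : N.-tuple {poly_N R})
    (t : nat -> R) (c : 'cV[R]_(coef_dim n m k N)) (j : 'I_n.-1) : 'cV[R]_k :=
  Dmx R k m *m (piece p t c (left_ord j) (t j.+1)
                - piece p t c (right_ord j) (t j.+1)).

Definition jumps (R : realType) (n m k N : nat) (p : N.-tuple {poly_N R})
    (t : nat -> R) (c : 'cV[R]_(coef_dim n m k N)) :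
    'cV[R]_(jump_dim n k) :=
  \mxcol_(j < n.-1) jump p t c j.

Definition dae_residual (R : realType) (k m : nat) (A : R -> 'M[R]_(m, k))
    (B : R -> 'M[R]_m) (q : R -> 'cV[R]_m) (x : R -> 'cV[R]_m) (s : R) :
    'cV[R]_m :=
  A s *m derive1 (fun u => Dmx R k m *m x u) s
  + B s *m x s - q s.

Definition colloc_point (R : realType) (M : nat) (t : nat -> R)
    (rho : 'I_M -> R) (j : nat) (i : 'I_M) : R :=
  t j + rho i * step t j.

Definition residuals (R : realType) (n m k N M : nat) (p : N.-tuple {poly_N R})
    (t : nat -> R) (rho : 'I_M -> R) (A : R -> 'M[R]_(m, k))
    (B : R -> 'M[R]_m) (q : R -> 'cV[R]_m) (c : 'cV[R]_(coef_dim n m k N)) :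
    'cV[R]_(colloc_dim n m M) :=
  \mxcol_(j < n) (Num.sqrt (step t j) *:
    \mxcol_(i < M) dae_residual A B q (piece p t c j) (colloc_point t rho j i)).

(* diag (L (x) I_m, ..., L (x) I_m), with n blocks. *)
Definition calL (R : realType) (n m M : nat) (L : 'M[R]_M) :
    'M[R]_(colloc_dim n m M) :=
  \mxdiag_(j < n) \mxblock_(i < M, i' < M) ((L i i')%:M : 'M[R]_m).

Lemma gram_eq0 (R : realType) (p : nat) (v : 'cV[R]_p) :
  v^T *m v = 0 -> v = 0.
Proof.
move=> /matrixP/(_ 0 0); rewrite !mxE => /eqP.
rewrite psumr_eq0 => [/allP v0|i _]; last by rewrite mxE -expr2 sqr_ge0.
apply/colP => i; have := v0 i (mem_index_enum i).
by rewrite !mxE mulf_eq0 orbb => /eqP.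
Qed.

Lemma gram_unit (R : realType) (p q : nat) (X : 'M[R]_(p, q)) :
  row_free X -> X *m X^T \in unitmx.
Proof.
move=> fX; rewrite -row_free_unit -kermx_eq0; apply/rowV0P => u.
move=> /sub_kermxP uXX; apply/(row_free_inj fX); rewrite mul0mx.
apply: trmx_inj; rewrite trmx0; apply: gram_eq0.
by rewrite trmxK trmx_mul mulmxA -(mulmxA u) uXX mul0mx.
Qed.

Lemma mp_invP (R : realType) (p q : nat) (X : 'M[R]_(p, q)) : penrose X (mp_inv X).
Proof.
rewrite /mp_inv; apply: (xgetPex 0).
have [rk [F [G [XE fF fG]]]] : exists rk, exists F : 'M[R]_(p, rk),
    exists G : 'M[R]_(rk, q), [/\ X = F *m G, row_free F^T & row_free G].
  exists (\rank X), (col_base X), (row_base X); rewrite mulmx_base.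
  by split; rewrite ?row_base_free // /row_free mxrank_tr; exact: col_base_full.
have uG : G *m G^T \in unitmx by rewrite gram_unit.
have uF : F^T *m F \in unitmx by rewrite -{2}[F]trmxK gram_unit.
exists (G^T *m invmx (G *m G^T) *m (invmx (F^T *m F) *m F^T)) => /=.
set a := invmx _; set b := invmx _.
have aT : a^T = a by rewrite trmx_inv trmx_mul trmxK.
have bT : b^T = b by rewrite trmx_inv trmx_mul trmxK.
have XY : X *m (G^T *m a *m (b *m F^T)) = F *m b *m F^T.
  by rewrite XE !mulmxA -(mulmxA F G) -(mulmxA F _ a) mulmxV // mulmx1.
have YX : G^T *m a *m (b *m F^T) *m X = G^T *m a *m G.
  by rewrite XE -!mulmxA (mulmxA F^T) (mulmxA b) mulVmx // mul1mx.
split.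
- by rewrite XY XE -!mulmxA (mulmxA F^T) (mulmxA b) mulVmx // mul1mx.
- by rewrite YX -!mulmxA (mulmxA G) (mulmxA (G *m _)) mulmxV // mul1mx.
- by rewrite XY !trmx_mul trmxK bT mulmxA.
- by rewrite YX !trmx_mul trmxK aT mulmxA.
Qed.

(* Main.v *)
(* Since the jumps of a piecewise constant function are arbitrary, C has full row
   rank, and so has C + dC by a perturbation of the lower bound
   |z| <= |C^+| |C^T z|.  Hence D_Delta - D = - (C + dC)^+ dC D has norm at most
   |C^+| |dC| / (1 - varkappa) < 1 (the factor sqrt 2 kappa(C) + 1 is at least 1),
   and by a dimension count the columns of D_Delta are a basis of ker (C + dC).
   Writing c = D y and ct = D_Delta yt, both problems become unconstrained
   least-squares problems with matrices X = A D and X' = (A + dA) D_Delta = X + RR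
   of full column rank.  With e = yt - y and rho = r - X y, the normal equations
   give |X' e|^2 = <X' e, rho> + <X' e, dr - RR y>.  As rho is orthogonal to the
   range of X and the ranges of X and X' have the same dimension,
   <X' e, rho> <= |(A P)^+| |RR| |rho| |X' e|. *)
Require Import Defs.
From mathcomp Require Import all_boot all_order all_algebra.
From mathcomp Require Import all_classical all_reals all_analysis.
From mathcomp Require Import ring lra.
Import Order.TTheory GRing.Theory Num.Theory numFieldNormedType.Exports.
Local Open Scope classical_set_scope.
Local Open Scope ring_scope.

Set Implicit Arguments.
Unset Strict Implicit.
Unset Printing Implicit Defensive.

(** * Euclidean inner product and norm *)

Section EuclideanNorm.
Context {R : realType}.

Definition dot {p : nat} (u v : 'cV[R]_p) : R := (u^T *m v) 0 0.

Lemma dotE p (u v : 'cV[R]_p) : dot u v = \sum_i u i 0 * v i 0.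
Proof. by rewrite /dot mxE; apply: eq_bigr => i _; rewrite mxE. Qed.

Lemma dotC p (u v : 'cV[R]_p) : dot u v = dot v u.
Proof. by rewrite !dotE; apply: eq_bigr => i _; rewrite mulrC. Qed.

Lemma dotDr p (u v w : 'cV[R]_p) : dot u (v + w) = dot u v + dot u w.
Proof. by rewrite /dot mulmxDr mxE. Qed.

Lemma dotZr p a (u v : 'cV[R]_p) : dot u (a *: v) = a * dot u v.
Proof. by rewrite /dot -scalemxAr mxE. Qed.

Lemma dotNr p (u v : 'cV[R]_p) : dot u (- v) = - dot u v.
Proof. by rewrite /dot mulmxN mxE. Qed.

Lemma dot0r p (u : 'cV[R]_p) : dot u 0 = 0.
Proof. by rewrite /dot mulmx0 mxE. Qed.

Lemma dotBr p (u v w : 'cV[R]_p) : dot u (v - w) = dot u v - dot u w.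
Proof. by rewrite dotDr dotNr. Qed.

Lemma dotBl p (u v w : 'cV[R]_p) : dot (v - w) u = dot v u - dot w u.
Proof. by rewrite !(dotC _ u) dotBr. Qed.

Lemma dotDl p (u v w : 'cV[R]_p) : dot (v + w) u = dot v u + dot w u.
Proof. by rewrite !(dotC _ u) dotDr. Qed.

Lemma dotZl p a (u v : 'cV[R]_p) : dot (a *: u) v = a * dot u v.
Proof. by rewrite dotC dotZr dotC. Qed.

Lemma dot_mulmxl p q (X : 'M[R]_(p, q)) u v : dot (X *m u) v = dot u (X^T *m v).
Proof. by rewrite /dot trmx_mul mulmxA. Qed.

Lemma dot_mulmxr p q (X : 'M[R]_(p, q)) u v : dot u (X *m v) = dot (X^T *m u) v.
Proof. by rewrite dot_mulmxl trmxK. Qed.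

Lemma dotvv_ge0 p (u : 'cV[R]_p) : 0 <= dot u u.
Proof. by rewrite dotE sumr_ge0 // => i _; rewrite -expr2 sqr_ge0. Qed.

Lemma enormE p (u : 'cV[R]_p) : enorm u = Num.sqrt (dot u u).
Proof. by rewrite /enorm dotE. Qed.

Lemma enorm_ge0 p (u : 'cV[R]_p) : 0 <= enorm u.
Proof. exact: sqrtr_ge0. Qed.

Lemma enorm_sqr p (u : 'cV[R]_p) : enorm u ^+ 2 = dot u u.
Proof. by rewrite enormE sqr_sqrtr // dotvv_ge0. Qed.

Lemma dotvv_eq0 p (u : 'cV[R]_p) : (dot u u == 0) = (u == 0).
Proof.
apply/eqP/eqP => [u0|->]; last by rewrite dot0r.
by apply: gram_eq0; apply/matrixP => i j; rewrite !ord1 -/(dot u u) u0 mxE.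
Qed.

Lemma enorm_eq0 p (u : 'cV[R]_p) : (enorm u == 0) = (u == 0).
Proof. by rewrite -(dotvv_eq0 u) -enorm_sqr sqrf_eq0. Qed.

Lemma enorm0 p : enorm (0 : 'cV[R]_p) = 0.
Proof. by apply/eqP; rewrite enorm_eq0. Qed.

Lemma enormN p (u : 'cV[R]_p) : enorm (- u) = enorm u.
Proof. by rewrite !enormE dotNr dotC dotNr opprK. Qed.

Lemma enormZ p a (u : 'cV[R]_p) : enorm (a *: u) = `|a| * enorm u.
Proof.
rewrite !enormE dotZr dotC dotZr mulrA -expr2 sqrtrM ?sqr_ge0 //.
by rewrite sqrtr_sqr.
Qed.

Lemma enorm_le p (u : 'cV[R]_p) x : 0 <= x -> dot u u <= x ^+ 2 -> enorm u <= x.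
Proof. by move=> x0; rewrite -enorm_sqr ler_sqr ?nnegrE ?enorm_ge0. Qed.

Lemma CauchySchwarz_dot p (u v : 'cV[R]_p) : dot u v <= enorm u * enorm v.
Proof.
apply: le_trans (ler_norm _) _.
rewrite -ler_sqr ?nnegrE ?mulr_ge0 ?enorm_ge0 // real_normK ?num_real //.
rewrite exprMn !enorm_sqr.
have [->|v0] := eqVneq v 0; first by rewrite !dot0r mulr0 expr0n.
have vv : 0 < dot v v by rewrite lt_def dotvv_ge0 dotvv_eq0 v0.
(* The squared norm of this vector is <v,v> (<u,u> <v,v> - <u,v>^2), and <v,v> > 0. *)
have := dotvv_ge0 (dot v v *: u - dot u v *: v).
rewrite !(dotBr, dotBl, dotZr, dotZl) (dotC v u) => h.
rewrite -subr_ge0 -(pmulr_rge0 _ vv); apply: le_trans h _.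
by rewrite le_eqVlt; apply/orP; left; apply/eqP; ring.
Qed.

Lemma ler_enormD p (u v : 'cV[R]_p) : enorm (u + v) <= enorm u + enorm v.
Proof.
apply: enorm_le; first by rewrite addr_ge0 ?enorm_ge0.
rewrite !(dotDr, dotDl) (dotC v u) sqrrD !enorm_sqr.
have := CauchySchwarz_dot u v; lra.
Qed.

Lemma ler_enormB p (u v : 'cV[R]_p) : enorm (u - v) <= enorm u + enorm v.
Proof. by rewrite -(enormN v) ler_enormD. Qed.

End EuclideanNorm.

(** * Spectral norm: finiteness, transposes, orthogonal projectors *)

Section SpectralNorm.
Context {R : realType}.

Lemma spectral_norm_has_sup p q (X : 'M[R]_(p, q)) :
  has_sup [set enorm (X *m v) | v in [set v : 'cV[R]_q | enorm v <= 1]].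
Proof.
split; first by exists (enorm (X *m 0)), 0; rewrite //= enorm0.
(* The upper bound is the Frobenius norm: Cauchy-Schwarz is applied to each row of [X]. *)
exists (Num.sqrt (\sum_i enorm (row i X)^T ^+ 2)) => _ [v /= v1 <-].
rewrite ler_wsqrtr // ler_sum // => i _.
have -> : (X *m v) i 0 = dot (row i X)^T v.
  by rewrite dotE mxE; apply: eq_bigr => j _; rewrite !mxE.
have bnd w : enorm w <= 1 -> dot (row i X)^T w <= enorm (row i X)^T.
  move=> w1; apply: le_trans (CauchySchwarz_dot _ _) _.
  by rewrite ler_piMr // enorm_ge0.
rewrite -(real_normK (num_real _)) ler_sqr ?nnegrE ?enorm_ge0 //.
by rewrite ler_norml lerNl -dotNr !bnd // enormN.
Qed.

Lemma spectral_norm_ge0 p q (X : 'M[R]_(p, q)) : 0 <= spectral_norm X.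
Proof.
apply: (le_trans (enorm_ge0 (X *m 0))).
apply: ub_le_sup; first by case: (spectral_norm_has_sup X).
by exists 0; rewrite //= enorm0.
Qed.

Lemma enorm_mulmx p q (X : 'M[R]_(p, q)) v :
  enorm (X *m v) <= spectral_norm X * enorm v.
Proof.
have [->|v0] := eqVneq v 0; first by rewrite mulmx0 !enorm0 mulr0.
have v_gt0 : 0 < enorm v by rewrite lt_def enorm_eq0 v0 enorm_ge0.
rewrite -ler_pdivrMr // mulrC.
have -> : (enorm v)^-1 * enorm (X *m v) = enorm (X *m ((enorm v)^-1 *: v)).
  by rewrite -scalemxAr enormZ gtr0_norm // invr_gt0.
apply: ub_le_sup; first by case: (spectral_norm_has_sup X).
exists ((enorm v)^-1 *: v) => //=.
by rewrite enormZ gtr0_norm ?invr_gt0 // mulVf ?gt_eqF.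
Qed.

Lemma spectral_norm_le p q (X : 'M[R]_(p, q)) x : 0 <= x ->
  (forall v, enorm (X *m v) <= x * enorm v) -> spectral_norm X <= x.
Proof.
move=> x0 Xx; apply: ge_sup; first by case: (spectral_norm_has_sup X).
by move=> _ [v /= v1 <-]; apply: le_trans (Xx v) _; rewrite ler_piMr.
Qed.

(** By duality |X^T v|^2 = <v, X X^T v> <= |v| |X| |X^T v|, and one factor |X^T v| cancels. *)
Lemma enorm_trmx_mulmx p q (X : 'M[R]_(p, q)) v :
  enorm (X^T *m v) <= spectral_norm X * enorm v.
Proof.
have [->|Xv0] := eqVneq (X^T *m v) 0.
  by rewrite enorm0 mulr_ge0 ?spectral_norm_ge0 ?enorm_ge0.
have Xv_gt0 : 0 < enorm (X^T *m v) by rewrite lt_def enorm_eq0 Xv0 enorm_ge0.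
rewrite -(ler_pM2l Xv_gt0) -expr2 enorm_sqr -dot_mulmxl.
apply: le_trans (CauchySchwarz_dot _ _) _.
by rewrite mulrA ler_wpM2r ?enorm_ge0 // mulrC enorm_mulmx.
Qed.

Lemma enorm_orthoproj p (P : 'M[R]_p) v : P^T = P -> P *m P = P ->
  enorm (P *m v) <= enorm v.
Proof.
move=> PT PP; have [->|Pv0] := eqVneq (P *m v) 0.
  by rewrite enorm0 enorm_ge0.
have Pv_gt0 : 0 < enorm (P *m v) by rewrite lt_def enorm_eq0 Pv0 enorm_ge0.
rewrite -(ler_pM2l Pv_gt0) -expr2 enorm_sqr.
by rewrite dot_mulmxr PT mulmxA PP CauchySchwarz_dot.
Qed.

End SpectralNorm.

(** * Normal equations and perturbation of full-rank least-squares problems *)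

Section LeastSquares.
Context {R : realType}.

Lemma inj_row_free_trmx p q (X : 'M[R]_(p, q)) :
  (forall v : 'cV[R]_q, X *m v = 0 -> v = 0) -> row_free X^T.
Proof.
move=> Xinj; apply: inj_row_free => u uX; apply: trmx_inj; rewrite trmx0.
by apply: Xinj; rewrite -[X]trmxK -trmx_mul uX trmx0.
Qed.

Lemma row_free_trmx_inj p q (X : 'M[R]_(p, q)) (v : 'cV[R]_q) :
  row_free X^T -> X *m v = 0 -> v = 0.
Proof.
move=> Xf Xv; apply: trmx_inj; apply: (row_free_inj Xf).
by rewrite -trmx_mul Xv !trmx0 mul0mx.
Qed.

Lemma inj_surj_mulmx p (X : 'M[R]_p) (w : 'cV[R]_p) :
  (forall v : 'cV[R]_p, X *m v = 0 -> v = 0) -> exists v, X *m v = w.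
Proof.
move=> /inj_row_free_trmx; rewrite row_free_unit unitmx_tr => uX.
by exists (invmx X *m w); rewrite mulKVmx.
Qed.

Lemma normal_equation p q (X : 'M[R]_(p, q)) (b : 'cV[R]_p) (y : 'cV[R]_q) :
  (forall z, enorm (X *m y - b) <= enorm (X *m z - b)) ->
  X^T *m (X *m y - b) = 0.
Proof.
move=> ymin; move eE : (X *m y - b) => e; move gE : (X^T *m e) => g.
apply/eqP; rewrite -dotvv_eq0.
set G := dot g g; set H := dot (X *m g) (X *m g).
have H0 : 0 <= H := dotvv_ge0 _.
have G0 : 0 <= G := dotvv_ge0 _.
(* Moving from [y] to [y - x *: g], a descent step, changes the squared residual by -2 x G + x^2 H,
   which minimality makes nonnegative. *)
have key x : 0 <= x -> 2 * x * G <= x ^+ 2 * H.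
  move=> x0; have := ymin (y - x *: g).
  rewrite mulmxBr -scalemxAr addrAC eE -(@ler_sqr _ (enorm e)).
  2,3: by rewrite nnegrE enorm_ge0.
  rewrite !enorm_sqr !(dotBl, dotBr, dotZl, dotZr) (dotC (X *m g) e).
  rewrite dot_mulmxr gE -/G -/H => h; move: h; lra.
have H1 : 0 < H + 1 by rewrite ltr_wpDl.
(* The quadratic is smallest at G / H; the denominator H + 1 also covers H = 0. Clearing it leaves
   (H + 2) G^2 <= 0. *)
have := key (G / (H + 1)); rewrite divr_ge0 ?(ltW H1) // => /(_ isT).
move=> /(ler_wpM2l (sqr_ge0 (H + 1))).
have -> : (H + 1) ^+ 2 * (2 * (G / (H + 1)) * G) = 2 * (H + 1) * G ^+ 2.
  by field; rewrite gt_eqF.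
have -> : (H + 1) ^+ 2 * ((G / (H + 1)) ^+ 2 * H) = H * G ^+ 2.
  by field; rewrite gt_eqF.
move=> h; have := sqr_ge0 G; rewrite -(sqrf_eq0 G) eq_le => -> /=.
rewrite andbT; have := mulr_ge0 H0 (sqr_ge0 G); lra.
Qed.

Section Perturbation.
Variables (p q : nat) (X X' : 'M[R]_(p, q)) (K x : R).
Hypotheses (K_ge0 : 0 <= K) (x_ge0 : 0 <= x) (Kx_lt1 : K * x < 1).
Hypothesis XK : forall w : 'cV[R]_q, enorm w <= K * enorm (X *m w).
Hypothesis XX' : forall w : 'cV[R]_q, enorm (X' *m w - X *m w) <= x * enorm w.

(** From |w| <= K |X w| <= K |X' w| + K x |w| the last term is absorbed on the left because K x < 1.
    It serves for X = C^T as well as for X = A D. *)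
Lemma enorm_perturb w : enorm w <= K / (1 - K * x) * enorm (X' *m w).
Proof.
rewrite mulrAC ler_pdivlMr ?subr_gt0 //.
have : K * enorm (X *m w) <= K * (enorm (X' *m w) + x * enorm w).
  rewrite ler_wpM2l // -[X *m w](subKr (X' *m w)).
  by apply: le_trans (ler_enormB _ _) _; rewrite lerD2l.
have := XK w; lra.
Qed.

(** If X z is orthogonal to the range of X', then |X z|^2 = <X z, X z - X' z> <= K x |X z|^2 with K
    x < 1. Hence the square matrix X'^T X is invertible, and every X' w is the orthogonal projection
    of some X z. *)
Lemma acute_perturb (z : 'cV[R]_q) : X'^T *m X *m z = 0 -> z = 0.
Proof.
rewrite -mulmxA => h.
have h1 : dot (X *m z) (X *m z) <= K * x * dot (X *m z) (X *m z).
  have -> : dot (X *m z) (X *m z) = dot (X *m z) (- (X' *m z - X *m z)).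
    by rewrite opprB dotBr (dotC _ (X' *m z)) (dot_mulmxl X') h dot0r subr0.
  apply: le_trans (CauchySchwarz_dot _ _) _; rewrite enormN.
  apply: (@le_trans _ _ (enorm (X *m z) * (x * (K * enorm (X *m z))))).
    rewrite ler_wpM2l ?enorm_ge0 //; apply: le_trans (XX' z) _.
    by rewrite ler_wpM2l.
  rewrite opprB dotBr (dotC _ (X' *m z)) (dot_mulmxl X') h dot0r subr0 -enorm_sqr.
  by rewrite le_eqVlt; apply/orP; left; apply/eqP; ring.
have : dot (X *m z) (X *m z) == 0.
  rewrite eq_le dotvv_ge0 andbT leNgt; apply/negP => h2.
  by move: h1; rewrite leNgt gtr_pMl // Kx_lt1.
rewrite dotvv_eq0 => /eqP Xz.
have := XK z; rewrite Xz enorm0 mulr0 => z0.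
by apply/eqP; rewrite -enorm_eq0 eq_le z0 enorm_ge0.
Qed.

(* The angle between the ranges of X and X' is the same in both directions
   because they have equal dimension: X' w is the projection of some X z onto
   the range of X', and X z is close to X' z. *)
Lemma dot_orthogonal_perturb (rho : 'cV[R]_p) (w : 'cV[R]_q) : X^T *m rho = 0 ->
  dot rho (X' *m w) <= K * x * enorm rho * enorm (X' *m w).
Proof.
move=> Xrho; have Kx_ge0 : 0 <= K * x by rewrite mulr_ge0.
have [z] := inj_surj_mulmx (X'^T *m X' *m w) acute_perturb.
rewrite -!mulmxA; set u := X' *m w; set v := X *m z => zw.
have X'uv a : dot (X' *m a) u = dot (X' *m a) v by rewrite !dot_mulmxl zw.
have uv : dot u v = dot u u by rewrite X'uv.
(* As [u] is the projection of [v] onto the range of X', the left side is the squared distance of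
   [v] from that range, hence at most |X' z - v|^2 <= x^2 |z|^2. *)
have uuvv : dot v v - dot u u <= (K * x) ^+ 2 * dot v v.
  have E : dot v v - dot u u + dot (u - X' *m z) (u - X' *m z) =
      dot (X' *m z - v) (X' *m z - v).
    rewrite !(dotBl, dotBr) (dotC v) -X'uv (dotC u (X' *m z)); ring.
  apply: (@le_trans _ _ (dot (X' *m z - v) (X' *m z - v))).
    by rewrite -E lerDl dotvv_ge0.
  rewrite -!enorm_sqr -exprMn ler_sqr ?nnegrE ?mulr_ge0 ?enorm_ge0 //.
  apply: le_trans (XX' z) _; rewrite [K * x]mulrC -mulrA ler_wpM2l //.
have [v0|v_neq0] := eqVneq v 0.
  have /eqP : dot u u = 0 by rewrite -uv v0 dot0r.
  by rewrite dotvv_eq0 => /eqP ->; rewrite dot0r enorm0 mulr0.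
have vv_gt0 : 0 < dot v v by rewrite lt_def dotvv_eq0 v_neq0 dotvv_ge0.
(* Since <u,v> = <u,u>, the vector [al *: v] is the projection of [u] onto the line of [v]. It is
   orthogonal to [rho], and |u - al v|^2 = (1 - |u|^2 / |v|^2) |u|^2. *)
set al := dot u u / dot v v.
have -> : dot rho u = dot rho (u - al *: v).
  by rewrite dotBr dotZr (dotC rho v) dot_mulmxl Xrho dot0r mulr0 subr0.
apply: le_trans (CauchySchwarz_dot _ _) _.
rewrite mulrAC [leRHS]mulrC ler_wpM2l ?enorm_ge0 //.
apply: enorm_le; first by rewrite mulr_ge0 ?enorm_ge0.
rewrite !(dotBl, dotBr, dotZl, dotZr) (dotC v u) uv exprMn enorm_sqr.
have -> : dot u u - al * dot u u - al * (dot u u - al * dot v v) =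
    (dot v v - dot u u) / dot v v * dot u u.
  by rewrite /al; field; rewrite gt_eqF.
by rewrite ler_wpM2r ?dotvv_ge0 // ler_pdivrMr.
Qed.

Lemma least_squares_perturbation (b db : 'cV[R]_p) (y y' : 'cV[R]_q) :
  X^T *m (X *m y - b) = 0 -> X'^T *m (X' *m y' - (b + db)) = 0 ->
  enorm (y - y') <=
    K / (1 - K * x) * (x * (enorm y + K * enorm (b - X *m y)) + enorm db).
Proof.
move=> yb y'b; rewrite -opprB enormN; set e := y' - y.
apply: le_trans (enorm_perturb e) _.
rewrite ler_wpM2l //; first by rewrite divr_ge0 // subr_ge0 ltW.
have [->|e0] := eqVneq (X' *m e) 0.
  by rewrite enorm0 addr_ge0 ?mulr_ge0 ?addr_ge0 ?mulr_ge0 ?enorm_ge0.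
have e_gt0 : 0 < enorm (X' *m e) by rewrite lt_def enorm_eq0 e0 enorm_ge0.
rewrite -(ler_pM2l e_gt0) -expr2 enorm_sqr.
(* X' e = X' y' - X' y, and X' e is orthogonal to the perturbed residual, so X' y' may be replaced
   by b + db in the second factor. *)
have -> : dot (X' *m e) (X' *m e) =
    dot (b - X *m y) (X' *m e) + dot (X' *m e) (db - (X' *m y - X *m y)).
  have : dot (X' *m e) (X' *m y' - (b + db)) = 0.
    by rewrite dot_mulmxl y'b dot0r.
  rewrite (dotC (b - X *m y)) -dotDr -[X in _ -> _ = X]addr0 => <-.
  rewrite -dotDr {2}/e mulmxBr; congr dot.
  by apply/matrixP => i j; rewrite !mxE; ring.
have Xb : X^T *m (b - X *m y) = 0 by rewrite -opprB mulmxN yb oppr0.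
have h1 := dot_orthogonal_perturb e Xb.
have h2 : dot (X' *m e) (db - (X' *m y - X *m y)) <=
    enorm (X' *m e) * (enorm db + x * enorm y).
  apply: le_trans (CauchySchwarz_dot _ _) _; rewrite ler_wpM2l ?enorm_ge0 //.
  by apply: le_trans (ler_enormB _ _) _; rewrite lerD2l.
apply: le_trans (lerD h1 h2) _.
by rewrite le_eqVlt; apply/orP; left; apply/eqP; ring.
Qed.

End Perturbation.
End LeastSquares.

(** * Pseudoinverse and kernel under perturbation of a matrix of full row rank *)

Section FullRowRank.
Context {R : realType}.

Lemma mulmx_mp_inv p q (C : 'M[R]_(p, q)) : row_free C -> C *m mp_inv C = 1%:M.
Proof.
move=> Cf; apply: (row_free_inj Cf); rewrite mul1mx.
by case: (mp_invP C).
Qed.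

(** Full row rank gives (C^+)^T C^T = (C C^+)^T = I. *)
Lemma enorm_mp_inv_trmx p q (C : 'M[R]_(p, q)) z : row_free C ->
  enorm z <= spectral_norm (mp_inv C) * enorm (C^T *m z).
Proof.
move=> Cf; rewrite -[z in leLHS]mul1mx -trmx1 -(mulmx_mp_inv Cf) trmx_mul -mulmxA.
exact: enorm_trmx_mulmx.
Qed.

(** A converse: a lower bound for X^T controls X^+. With Y = X^+, the vector v = Y z equals X^T Y^T
    v, so |v|^2 = <Y^T v, X v> <= x |X^T Y^T v| |X Y z| = x |v| |X Y z|, and X Y is an orthogonal
    projector. *)
Lemma enorm_mp_inv_le p q (X : 'M[R]_(p, q)) x z : 0 <= x ->
  (forall y, enorm y <= x * enorm (X^T *m y)) ->
  enorm (mp_inv X *m z) <= x * enorm z.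
Proof.
move=> x0 Xx; case: (mp_invP X) => XYX YXY XYT YXT.
set Y := mp_inv X in XYX YXY XYT YXT *.
have [->|v0] := eqVneq (Y *m z) 0.
  by rewrite enorm0 mulr_ge0 ?enorm_ge0.
have v_gt0 : 0 < enorm (Y *m z) by rewrite lt_def enorm_eq0 v0 enorm_ge0.
have YE : Y *m z = X^T *m (Y^T *m (Y *m z)).
  by rewrite mulmxA -trmx_mul YXT -{1}YXY !mulmxA.
rewrite -(ler_pM2l v_gt0) -expr2 enorm_sqr.
rewrite {1}YE dot_mulmxl trmxK.
apply: le_trans (CauchySchwarz_dot _ _) _.
rewrite mulrCA mulrA; apply: ler_pM; rewrite ?enorm_ge0 //.
  by rewrite [in leRHS]YE; exact: Xx.
rewrite mulmxA; apply: enorm_orthoproj => //.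
by rewrite mulmxA XYX.
Qed.

Section Perturbation.
Variables (p q : nat) (C dC : 'M[R]_(p, q)).
Hypothesis C_free : row_free C.
Hypothesis dC_lt1 : spectral_norm (mp_inv C) * spectral_norm dC < 1.
Let x := spectral_norm (mp_inv C)
  / (1 - spectral_norm (mp_inv C) * spectral_norm dC).

Let enorm_trmx_perturb y : enorm y <= x * enorm ((C + dC)^T *m y).
Proof.
apply: (@enorm_perturb _ _ _ C^T); rewrite ?spectral_norm_ge0 //.
  by move=> w; exact: enorm_mp_inv_trmx.
move=> w; rewrite -mulmxBl linearD /= addrAC subrr add0r.
exact: enorm_trmx_mulmx.
Qed.

Lemma row_free_perturb : row_free (C + dC).
Proof.
rewrite -[C + dC]trmxK; apply: inj_row_free_trmx => v v0.
have := enorm_trmx_perturb v; rewrite v0 enorm0 mulr0 => v_le0.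
by apply/eqP; rewrite -enorm_eq0 eq_le v_le0 enorm_ge0.
Qed.

Lemma enorm_mp_inv_perturb z : enorm (mp_inv (C + dC) *m z) <= x * enorm z.
Proof.
apply: enorm_mp_inv_le; last exact: enorm_trmx_perturb.
by rewrite divr_ge0 ?spectral_norm_ge0 // subr_ge0 ltW.
Qed.

End Perturbation.

Lemma mulmx_ext p q (X Y : 'M[R]_(p, q)) :
  (forall v : 'cV[R]_q, X *m v = Y *m v) -> X = Y.
Proof.
move=> XY; apply/matrixP => i j.
by have /colP/(_ i) := XY (delta_mx j 0); rewrite -!colE !mxE.
Qed.

Lemma mulmx_ker_basis p q s (C : 'M[R]_(p, q)) (D : 'M[R]_(q, s)) :
  orthonormal_basis_ker C D -> C *m D = 0.
Proof.
move=> [_ kerD]; apply: mulmx_ext => v; rewrite mul0mx -mulmxA.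
by apply/kerD; exists v.
Qed.

(** The basis [D] fixes s = q - p. As [C'] also has rank p, its kernel has dimension s, so the s
    independent columns of [E] inside it span it. Everything is transposed because [kermx] and
    [submx] concern row spaces. *)
Lemma ker_basis_perturb p q s (C C' : 'M[R]_(p, q)) (D E : 'M[R]_(q, s)) :
  row_free C -> row_free C' -> orthonormal_basis_ker C D ->
  C' *m E = 0 -> (forall y : 'cV[R]_s, E *m y = 0 -> y = 0) ->
  forall v : 'cV[R]_q, C' *m v = 0 -> exists y, v = E *m y.
Proof.
move=> Cf C'f [DD kerD] C'E /inj_row_free_trmx Ef v C'v.
have Df : row_free D^T.
  by apply: inj_row_free_trmx => y Dy; rewrite -[y]mul1mx -DD -mulmxA Dy mulmx0.
have rD : s = (q - p)%N.
  have DC : (D^T == kermx C^T)%MS.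
    apply/andP; split.
      apply/sub_kermxP; rewrite -trmx_mul mulmx_ker_basis ?trmx0 //.
    apply/rV_subP => u /sub_kermxP uC.
    have [|y uy] := (kerD u^T).1; first by rewrite -[C]trmxK -trmx_mul uC trmx0.
    by rewrite -[u]trmxK uy trmx_mul submxMl.
  by rewrite -(eqP Df) (eqmx_rank DC) mxrank_ker mxrank_tr (eqP Cf).
have EC' : (E^T <= kermx C'^T)%MS.
  by apply/sub_kermxP; rewrite -trmx_mul C'E trmx0.
have /andP[_ h] : (E^T == kermx C'^T)%MS.
  by rewrite -(geq_leqif (mxrank_leqif_eq EC')) mxrank_ker mxrank_tr
    (eqP C'f) (eqP Ef) rD.
have : (v^T <= E^T)%MS.
  apply: submx_trans h; apply/sub_kermxP; by rewrite -trmx_mul C'v trmx0.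
by move=> /submxP[y vy]; exists y^T; apply: trmx_inj; rewrite vy trmx_mul trmxK.
Qed.

End FullRowRank.

(** * The orthogonal projector onto a kernel *)

Section KernelProjector.
Context {R : realType} {p q : nat}.
Variable X : 'M[R]_(p, q).
Let P : 'M[R]_q := 1%:M - mp_inv X *m X.

Lemma mulmx_ker_proj : X *m P = 0.
Proof.
rewrite mulmxBr mulmx1 mulmxA; case: (mp_invP X) => -> _ _ _.
by rewrite subrr.
Qed.

Lemma enorm_ker_proj (v : 'cV[R]_q) : enorm (P *m v) <= enorm v.
Proof.
apply: enorm_orthoproj.
  by rewrite linearB /= trmx1; case: (mp_invP X) => _ _ _ ->.
by rewrite {1}/P mulmxBl mul1mx -mulmxA mulmx_ker_proj mulmx0 subr0.
Qed.

End KernelProjector.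

(** * Perturbation of the abstract constrained least-squares problem *)

Section ConstrainedLeastSquares.
Context {R : realType}.
Variables (p q g s : nat) (A dA : 'M[R]_(g, q)) (C dC : 'M[R]_(p, q)).
Variables (D : 'M[R]_(q, s)) (r dr : 'cV[R]_g) (c ct : 'cV[R]_q).
Hypotheses (C_free : row_free C) (D_basis : orthonormal_basis_ker C D).
Hypothesis AD_full : \rank (A *m D) = s.
Hypothesis c_sol : minimizer [set z | C *m z = 0]
  (fun z => enorm (A *m z - r) ^+ 2) c.
Hypothesis ct_sol : minimizer [set z | (C + dC) *m z = 0]
  (fun z => enorm ((A + dA) *m z - (r + dr))) ct.

Let P : 'M[R]_q := 1%:M - mp_inv C *m C.
Let PDelta : 'M[R]_q := 1%:M - mp_inv (C + dC) *m (C + dC).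
Let DDelta := PDelta *m D.
Let RR : 'M[R]_(g, s) := dA *m D + (A + dA) *m (DDelta - D).
Let K := spectral_norm (mp_inv (A *m P)).
Let kappaC := spectral_norm C * spectral_norm (mp_inv C).
Let varkappa := spectral_norm (mp_inv C) * spectral_norm dC.
Let gap := spectral_norm (mp_inv C) / (1 - varkappa)
  * (Num.sqrt 2 * kappaC + 1) * spectral_norm dC.

Let CD : C *m D = 0 := mulmx_ker_basis D_basis.

Let DTD : D^T *m D = 1%:M := D_basis.1.

Lemma enorm_ker_basis (y : 'cV[R]_s) : enorm (D *m y) = enorm y.
Proof. by rewrite !enormE dot_mulmxl mulmxA DTD mul1mx. Qed.

Lemma projector_ker_basis : P *m D = D.
Proof. by rewrite mulmxBl mul1mx -mulmxA CD mulmx0 subr0. Qed.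

(** Write P v = D y. Since P is symmetric and fixes the columns of D, D^T P = D^T, whence y = D^T P
    v = D^T v. *)
Lemma projectorE : P = D *m D^T.
Proof.
have DP : D^T *m P = D^T.
  rewrite mulmxBr mulmx1; case: (mp_invP C) => _ _ _ <-.
  by rewrite trmx_mul mulmxA -trmx_mul CD trmx0 mul0mx subr0.
apply: mulmx_ext => v; have /D_basis.2[y Py] : C *m (P *m v) = 0.
  by rewrite mulmxA mulmx_ker_proj mul0mx.
by rewrite Py -[D^T]DP -!mulmxA Py (mulmxA D^T) DTD mul1mx.
Qed.

Let AD_inj (y : 'cV[R]_s) : A *m D *m y = 0 -> y = 0.
Proof. by apply: row_free_trmx_inj; rewrite /row_free mxrank_tr AD_full. Qed.

(** This brings in |(A P)^+| as the constant for A D. For e = (A P)^+ A D w, the relations P D = D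
    and P = D D^T give A D (D^T e) = A D w, so w = D^T e by injectivity, and |D^T e| <= |e|. *)
Lemma enorm_le_mp_inv_proj (w : 'cV[R]_s) : enorm w <= K * enorm (A *m D *m w).
Proof.
set e := mp_inv (A *m P) *m (A *m D *m w).
have {1}-> : w = D^T *m e.
  apply/eqP; rewrite eq_sym -subr_eq0; apply/eqP/AD_inj.
  rewrite mulmxBr (mulmxA (A *m D)) -(mulmxA A) -projectorE /e.
  rewrite -{1 2}projector_ker_basis !mulmxA -(mulmxA _ A P).
  by case: (mp_invP (A *m P)) => -> _ _ _; rewrite subrr.
apply: (@le_trans _ _ (enorm e)).
  rewrite -enorm_ker_basis mulmxA; apply: enorm_orthoproj.
    by rewrite trmx_mul trmxK.
  by rewrite mulmxA -(mulmxA D) DTD mulmx1.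
exact: enorm_mulmx.
Qed.

Hypothesis varkappa_lt : varkappa < 1 / 2.

Let varkappa_lt1 : varkappa < 1.
Proof. by apply: lt_trans varkappa_lt _; lra. Qed.

Let h : R := spectral_norm (mp_inv C) / (1 - varkappa).

Let h_ge0 : 0 <= h.
Proof. by rewrite divr_ge0 ?spectral_norm_ge0 // subr_ge0 ltW. Qed.

Lemma enorm_DDelta_sub (v : 'cV[R]_s) :
  enorm (DDelta *m v - D *m v) <= h * spectral_norm dC * enorm v.
Proof.
have -> : DDelta *m v - D *m v = - (mp_inv (C + dC) *m (dC *m (D *m v))).
  rewrite /DDelta /PDelta mulmxBl mul1mx -mulmxA (mulmxDl C) CD add0r mulmxBl.
  by rewrite addrAC subrr add0r !mulmxA.
rewrite enormN; apply: (@le_trans _ _ (h * enorm (dC *m (D *m v)))).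
  by apply: enorm_mp_inv_perturb.
by rewrite -mulrA ler_wpM2l // -(enorm_ker_basis v) enorm_mulmx.
Qed.

Lemma DDelta_inj (v : 'cV[R]_s) : DDelta *m v = 0 -> v = 0.
Proof.
move=> v0; apply/eqP; rewrite -enorm_eq0 eq_le enorm_ge0 andbT leNgt.
apply/negP => v_gt0; have := enorm_DDelta_sub v.
rewrite v0 sub0r enormN enorm_ker_basis leNgt gtr_pMl // => /negP; apply.
(* The factor varkappa / (1 - varkappa) is below 1 exactly when varkappa < 1/2. *)
have -> : h * spectral_norm dC = varkappa / (1 - varkappa).
  by rewrite /h /varkappa mulrAC.
rewrite ltr_pdivrMr ?subr_gt0 // mul1r ltrBrDr.
by move: varkappa_lt; lra.
Qed.

Lemma gap_ge : h * spectral_norm dC <= gap.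
Proof.
rewrite /gap -/h [leRHS]mulrAC; apply: ler_peMr.
  by rewrite mulr_ge0 ?spectral_norm_ge0.
rewrite lerDr.
by rewrite !mulr_ge0 ?sqrtr_ge0 ?spectral_norm_ge0.
Qed.

Lemma RR_mulmx (y : 'cV[R]_s) : (A + dA) *m DDelta *m y - A *m D *m y = RR *m y.
Proof.
rewrite -mulmxBl; congr (_ *m y); rewrite /RR mulmxBr addrCA; congr (_ + _).
by rewrite mulmxDl opprD addrCA subrr addr0.
Qed.

(** This turns the smallness hypothesis into omega < 1. The term dA D is bounded through dA P
    because D = P D and D is isometric. *)
Lemma spectral_norm_RR :
  spectral_norm RR <= spectral_norm (dA *m P) + spectral_norm (A + dA) * gap.
Proof.
have gap_ge0 : 0 <= gap.
  by apply: le_trans gap_ge; rewrite mulr_ge0 ?spectral_norm_ge0.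
apply: spectral_norm_le => [|v].
  exact: addr_ge0 (spectral_norm_ge0 _) (mulr_ge0 (spectral_norm_ge0 _) gap_ge0).
rewrite /RR mulmxDl mulrDl; apply: le_trans (ler_enormD _ _) _; apply: lerD.
  rewrite -{1}projector_ker_basis (mulmxA dA) -(mulmxA _ D) -(enorm_ker_basis v).
  exact: enorm_mulmx.
rewrite -mulmxA -mulrA; apply: le_trans (enorm_mulmx _ _) _.
rewrite ler_wpM2l ?spectral_norm_ge0 // mulmxBl.
apply: le_trans (enorm_DDelta_sub v) _.
by rewrite ler_wpM2r ?enorm_ge0 // gap_ge.
Qed.

Hypothesis small :
  K * (spectral_norm (dA *m P)
       + spectral_norm (A + dA) * (spectral_norm (mp_inv C) / (1 - varkappa))
         * (Num.sqrt 2 * kappaC + 1) * spectral_norm dC) < 1.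

Let omega : R := K * spectral_norm RR.

Lemma omega_lt1 : omega < 1.
Proof.
apply: le_lt_trans small; rewrite ler_wpM2l ?spectral_norm_ge0 //.
by apply: le_trans spectral_norm_RR _; rewrite /gap !mulrA.
Qed.

(** The second part supplies the nonzero denominators of the relative bound: r = 0 or A P = 0 would
    force A D y = 0, hence y = 0 and c = 0. *)
Lemma constrained_lsq_perturbation :
  [/\ (enorm (c - ct) <=
        K / (1 - omega) *
          (spectral_norm RR * (enorm c + K * enorm (r - A *m c)) + enorm dr)
        + gap * enorm c) &
      (c != 0 -> 0 < enorm r /\ 0 < spectral_norm (A *m P))].
Proof.
case: c_sol => /= Cc c_min; case: ct_sol => /= Cct ct_min.
have /D_basis.2[y cE] := Cc.
have C'free : row_free (C + dC) by apply: row_free_perturb.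
have C'DDelta : (C + dC) *m DDelta = 0 by rewrite mulmxA mulmx_ker_proj mul0mx.
have [yt ctE] := ker_basis_perturb C_free C'free D_basis C'DDelta DDelta_inj Cct.
have ny : (A *m D)^T *m (A *m D *m y - r) = 0.
  apply: normal_equation => z.
  rewrite -ler_sqr ?nnegrE ?enorm_ge0 // -!mulmxA -cE; apply: c_min.
  by rewrite mulmxA CD mul0mx.
have nyt : ((A + dA) *m DDelta)^T *m ((A + dA) *m DDelta *m yt - (r + dr)) = 0.
  apply: normal_equation => z.
  rewrite -(mulmxA _ _ yt) -(mulmxA _ _ z) -ctE; apply: ct_min.
  by rewrite mulmxA C'DDelta mul0mx.
split.
  (* The first term is the error of the reduced problem, where [PDelta] contracts and [D] is
     isometric; the second, (D_Delta - D) y, is the displacement of the kernel and yields the [gap]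
     term. *)
  have -> : c - ct = DDelta *m (y - yt) - (DDelta *m y - D *m y).
    by rewrite cE ctE mulmxBr opprB [in RHS]addrC addrA subrK.
  apply: le_trans (ler_enormB _ _) _; apply: lerD; last first.
    apply: le_trans (enorm_DDelta_sub y) _; rewrite cE enorm_ker_basis.
    by rewrite ler_wpM2r ?enorm_ge0 // gap_ge.
  rewrite /DDelta -mulmxA; apply: le_trans (enorm_ker_proj _ _) _.
  rewrite enorm_ker_basis [in leRHS]cE enorm_ker_basis mulmxA.
  apply: least_squares_perturbation nyt => //; rewrite ?spectral_norm_ge0 //.
  - exact: omega_lt1.
  - exact: enorm_le_mp_inv_proj.
  - by move=> w; rewrite RR_mulmx enorm_mulmx.
move=> c0; have c_gt0 : 0 < enorm c by rewrite lt_def enorm_eq0 c0 enorm_ge0.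
have y_gt0 : 0 < enorm y by rewrite -enorm_ker_basis -cE.
split.
  rewrite lt_def enorm_eq0 enorm_ge0 andbT; apply: contra_neq c0 => r0.
  rewrite cE; move: ny; rewrite r0 subr0 => ny0.
  suff /AD_inj -> : A *m D *m y = 0 by rewrite mulmx0.
  apply/eqP; rewrite -dotvv_eq0 dot_mulmxl.
  by rewrite ny0 dot0r.
rewrite lt_def spectral_norm_ge0 andbT; apply: contraTneq y_gt0 => AP0.
have : A *m D *m y = 0.
  apply/eqP; rewrite -enorm_eq0 eq_le enorm_ge0 andbT.
  rewrite -projector_ker_basis !mulmxA -(mulmxA _ D).
  by apply: le_trans (enorm_mulmx _ _) _; rewrite AP0 mul0r.
by move/AD_inj => ->; rewrite enorm0 ltxx.
Qed.

End ConstrainedLeastSquares.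

(** * Full row rank of the constraint matrix *)

Section Jumps.
Context {R : realType}.

(** For every basis [p], the function [pbarj] of index 0 is the constant [step t j]; this explains
    the quotient in the coefficient with l = 0. The components from k on vanish. *)
Lemma piece_const (n m k N : nat) (p : N.-tuple {poly_N R}) (t : nat -> R)
    (G : 'I_n -> 'cV[R]_k) :
  (forall j, (j < n)%N -> t j < t j.+1) ->
  exists c : 'cV[R]_(coef_dim n m k N),
    forall j s, piece p t c j s = (Dmx R k m)^T *m G j.
Proof.
move=> t_incr.
pose c : 'cV[R]_(coef_dim n m k N) := \mxcol_(j < n) \mxcol_(kappa < m)
  \col_(l < ncoef k N kappa)
    (if l == 0%N :> nat then ((Dmx R k m)^T *m G j) kappa 0 / step t j else 0).
exists c => j u; apply/colP => kappa; rewrite mxE.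
under eq_bigr do rewrite /coef_at /c !mxcolK mxE.
have [kappa_lt|kappa_ge] := ltnP kappa k; last first.
  have -> : ((Dmx R k m)^T *m G j) kappa 0 = 0.
    rewrite mxE big1 // => i _; rewrite !mxE.
    case: eqP => [ik|_]; last by rewrite mul0r.
    by move: (ltn_ord i); rewrite ik ltnNge kappa_ge.
  by rewrite big1 // => l _; rewrite mul0r if_same mul0r.
have ncoef_gt0 : (0 < ncoef k N kappa)%N by rewrite /ncoef kappa_lt.
rewrite (bigD1 (Ordinal ncoef_gt0)) //= [X in _ + X]big1 ?addr0 => [|l l0].
  by rewrite /pbarj /= mulr1 divfK // subr_eq0 gt_eqF ?t_incr.
by rewrite ifN ?mul0r //.
Qed.

Lemma Dmx_trmx (k m : nat) : (k <= m)%N -> Dmx R k m *m (Dmx R k m)^T = 1%:M.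
Proof.
move=> km; rewrite /Dmx tr_pid_mx mul_pid_mx.
by rewrite minnn (minn_idPr km) pid_mx_1.
Qed.

Lemma jumps_surj (n m k N : nat) (p : N.-tuple {poly_N R}) (t : nat -> R)
    (b : 'cV[R]_(jump_dim n k)) :
  (k <= m)%N -> (forall j, (j < n)%N -> t j < t j.+1) ->
  exists c : 'cV[R]_(coef_dim n m k N), jumps p t c = b.
Proof.
move=> km t_incr.
(* Telescoping: the constant on subinterval j is the sum of all prescribed jumps at or after its
   right end, so consecutive constants differ by b_j. On the last subinterval the sum is empty. *)
have [c cE] := piece_const m p (fun j : 'I_n =>
  \sum_(i < n.-1 | (j <= i)%N) submxcol b i) t_incr.
exists c; apply/mxcolP => j; rewrite mxcolK /jump !cE -mulmxBr mulmxA.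
rewrite Dmx_trmx // mul1mx (bigD1 j) //=.
rewrite -addrA [X in _ + X](_ : _ = 0) ?addr0 //; apply/eqP.
rewrite subr_eq0; apply/eqP/eq_bigl => i.
by rewrite ltn_neqAle eq_sym andbC.
Qed.

Lemma jumps_row_free (n m k N : nat) (p : N.-tuple {poly_N R}) (t : nat -> R)
    (C : 'M[R]_(jump_dim n k, coef_dim n m k N)) :
  (k <= m)%N -> (forall j, (j < n)%N -> t j < t j.+1) ->
  (forall c, C *m c = jumps p t c) -> row_free C.
Proof.
move=> km t_incr CE; apply: inj_row_free => u uC; apply: trmx_inj.
(* A left null vector [u] is itself realized as a jump vector, so u u^T = u C c = 0. *)
have [c cE] := jumps_surj p u^T km t_incr.
rewrite trmx0; apply: gram_eq0.
by rewrite -[in X in _ *m X]cE trmxK -CE mulmxA uC mul0mx.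
Qed.

End Jumps.

(** * Absolute and relative bounds for the collocation problem *)

Theorem theorem5 (R : realType) (k m N n M l : nat)
  (k_gt0 : (0 < k)%N) (km : (k < m)%N) (N_gt0 : (1 <= N)%N)
  (n_ge2 : (2 <= n)%N) (MN : (N + 1 <= M)%N)
  (a b : R)
  (* partition *)
  (t : nat -> R) (ta : t 0%N = a) (tb : t n = b)
  (t_incr : forall j, (j < n)%N -> t j < t j.+1)
  (* boundary value problem *)
  (A : R -> 'M[R]_(m, k)) (B : R -> 'M[R]_m) (q : R -> 'cV[R]_m)
  (A_cont : {within `[a, b], continuous A})
  (B_cont : {within `[a, b], continuous B})
  (q_cont : {within `[a, b], continuous q})
  (Ga Gb : 'M[R]_(l, m)) (d : 'cV[R]_l)
  (kerG : forall v : 'cV[R]_m, Dmx R k m *m v = 0 ->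
    Ga *m v = 0 /\ Gb *m v = 0)
  (* polynomial basis *)
  (p : N.-tuple {poly_N R}) (p_basis : basis_of fullv p)
  (* constraint matrix *)
  (CC : 'M[R]_(jump_dim n k, coef_dim n m k N))
  (CC_def : forall c : 'cV[R]_(coef_dim n m k N), CC *m c = jumps p t c)
  (* collocation points and weight matrix *)
  (rho : 'I_M -> R) (rho01 : forall i, 0 <= rho i <= 1)
  (rho_incr : forall i i' : 'I_M, (i < i')%N -> rho i < rho i')
  (L : 'M[R]_M) (L_sympd : sympd L)
  (* least-squares matrix and right-hand side *)
  (AA : 'M[R]_(colloc_dim n m M + l, coef_dim n m k N))
  (r : 'cV[R]_(colloc_dim n m M + l))
  (AA_r_def : forall c : 'cV[R]_(coef_dim n m k N),
    AA *m c - r =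
    col_mx (sqrt_mx (calL n m L) *m residuals p t rho A B q c)
           (Ga *m piece p t c (first_ord (ltnW n_ge2)) a
            + Gb *m piece p t c (last_ord (ltnW n_ge2)) b - d))
  (* orthonormal basis of the kernel of CC *)
  (s : nat) (DD : 'M[R]_(coef_dim n m k N, s))
  (DD_basis : orthonormal_basis_ker CC DD)
  (AADD_full : \rank (AA *m DD) = s)
  (* perturbations *)
  (dAA : 'M[R]_(colloc_dim n m M + l, coef_dim n m k N))
  (dCC : 'M[R]_(jump_dim n k, coef_dim n m k N))
  (dr : 'cV[R]_(colloc_dim n m M + l))
  (c ct : 'cV[R]_(coef_dim n m k N))
  (c_sol : minimizer [set z : 'cV[R]_(coef_dim n m k N) | CC *m z = 0]
             (fun z => enorm (AA *m z - r) ^+ 2) c)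
  (ct_sol : minimizer [set z : 'cV[R]_(coef_dim n m k N) | (CC + dCC) *m z = 0]
             (fun z => enorm ((AA + dAA) *m z - (r + dr))) ct) :
  let dc := c - ct in
  let P := 1%:M - mp_inv CC *m CC in
  let PDelta := 1%:M - mp_inv (CC + dCC) *m (CC + dCC) in
  let DDelta := PDelta *m DD in
  let RR := dAA *m DD + (AA + dAA) *m (DDelta - DD) in
  let omega := spectral_norm (mp_inv (AA *m P)) * spectral_norm RR in
  let rr := r - AA *m c in
  let kappaC := spectral_norm CC * spectral_norm (mp_inv CC) in
  let kappaCA := spectral_norm (AA *m P) * spectral_norm (mp_inv (AA *m P)) in
  let varkappa := spectral_norm (mp_inv CC) * spectral_norm dCC in
  varkappa < 1 / 2 ->
  spectral_norm (mp_inv (AA *m P)) *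
    (spectral_norm (dAA *m P)
     + spectral_norm (AA + dAA) * (spectral_norm (mp_inv CC) / (1 - varkappa))
       * (Num.sqrt 2 * kappaC + 1) * spectral_norm dCC) < 1 ->
  enorm dc <=
    spectral_norm (mp_inv (AA *m P)) / (1 - omega) *
      (spectral_norm RR *
         (enorm c + spectral_norm (mp_inv (AA *m P)) * enorm rr) + enorm dr)
    + spectral_norm (mp_inv CC) / (1 - varkappa) * (Num.sqrt 2 * kappaC + 1)
      * spectral_norm dCC * enorm c
  /\
  (c != 0 ->
   enorm dc / enorm c <=
     1 / (1 - omega) *
       ((kappaCA
         + enorm rr / (spectral_norm (AA *m P) * enorm c) * kappaCA ^+ 2)
          * (spectral_norm RR / spectral_norm (AA *m P))
        + spectral_norm (mp_inv (AA *m P)) * enorm r / enorm c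
          * (enorm dr / enorm r))
     + spectral_norm (mp_inv CC) / (1 - varkappa) * (Num.sqrt 2 * kappaC + 1)
       * spectral_norm dCC).
Proof.
move=> dc P PDelta DDelta RR omega rr kappaC kappaCA varkappa varkappa_lt small.
have CC_free := jumps_row_free (ltnW km) t_incr CC_def.
have [abs_bound pos] := constrained_lsq_perturbation CC_free DD_basis AADD_full
  c_sol ct_sol varkappa_lt small.
split=> [//|c0].
have [r_gt0 AP_gt0] := pos c0.
have c_gt0 : 0 < enorm c by rewrite lt_def enorm_eq0 c0 enorm_ge0.
have om1 : omega < 1 := omega_lt1 CC_free DD_basis varkappa_lt small.
rewrite ler_pdivrMr //; apply: le_trans abs_bound _.
rewrite -/P -/PDelta -/DDelta -/RR -/omega -/rr.
(* Multiplied by |c|, the first term of the relative bound equals that of the absolute one: the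
   powers of |A P| in [kappaCA] cancel, as does |r|. *)
rewrite mulrDl lerD2r le_eqVlt; apply/orP; left; apply/eqP.
rewrite /kappaCA; field.
by rewrite subr_eq0 !gt_eqF.
Qed.
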